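(* Let $G$ be a simple graph on $n$ vertices and let $k$ be an integer with $1\le k\le n-1$. Suppose that $$\alpha(G)>\alpha(F_2(G))>\cdots>\alpha(F_k(G)).$$ Then $$\alpha(F_k(G))\ge k\,[\alpha(G)-k+1].$$
   Context: For a simple graph $G$ with vertex set $[n]=\{1,\dots,n\}$ and an integer $1\le k\le n$, the $k$-token graph $F_k(G)$ is the graph whose vertices are the $\binom{n}{k}$ $k$-subsets of $[n]$, two $k$-subsets $A,B$ being adjacent whenever their symmetric difference is $\{a,b\}$ with $a\in A$, $b\in B$ and $\{a,b\}\in E(G)$. In particular $F_1(G)\cong G$. The Laplacian matrix of a graph is $L=D-A$ (degree matrix minus adjacency matrix), with eigenvalues $0=\lambda_1\le\lambda_2\le\cdots$; the algebraic connectivity $\alpha(H)$ of a graph $H$ is its second smallest Laplacian eigenvalue $\lambda_2$. *)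

(* Defs.v *)
From mathcomp Require Import all_boot all_order all_algebra.
From mathcomp Require Import polyrcf.

Set Implicit Arguments.
Unset Strict Implicit.
Unset Printing Implicit Defensive.

Import Order.TTheory GRing.Theory Num.Theory.

Local Open Scope ring_scope.

Record sgraph (T : finType) := SGraph {
  adj : rel T;
  adj_sym : symmetric adj;
  adj_irr : irreflexive adj }.

Section TokenGraph.

Variables (T : finType) (G : sgraph T) (k : nat).

Definition ksubset : finType := {A : {set T} | #|A| == k}.

Definition token_adj : rel ksubset := fun A B =>
  [exists a in val A, exists b in val B,
     ((val A :\: val B) :|: (val B :\: val A) == [set a; b]) && adj G a b].

Lemma token_adj_sym : symmetric token_adj.
Proof.
suff H A B : token_adj A B -> token_adj B A by move=> A B; apply/idP/idP; apply: H.
case/exists_inP=> a aA /exists_inP[b bB /andP[eAB eab]].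
apply/exists_inP; exists b => //; apply/exists_inP; exists a => //.
by rewrite setUC (eqP eAB) setUC eqxx adj_sym.
Qed.

Lemma token_adj_irr : irreflexive token_adj.
Proof.
move=> A; apply/negbTE/negP => /exists_inP[a aA /exists_inP[b bA /andP[/eqP eAA _]]].
by have := set21 a b; rewrite -eAA setDv setU0 inE.
Qed.

Definition token_graph : sgraph ksubset := SGraph token_adj_sym token_adj_irr.

End TokenGraph.

Section Laplacian.

Variables (R : rcfType) (T : finType) (G : sgraph T).

Definition adjacency_mx : 'M[R]_#|T| :=
  \matrix_(i, j) (adj G (enum_val i) (enum_val j))%:R.

Definition degree_mx : 'M[R]_#|T| :=
  diag_mx (\row_i (#|[set y | adj G (enum_val i) y]|)%:R).

Definition laplacian : 'M[R]_#|T| := degree_mx - adjacency_mx.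

End Laplacian.

(* [rootsR p] lists the distinct roots of [p] in increasing order, so this is
   the nondecreasing sequence of the eigenvalues of [A] lying in [R], repeated
   according to their algebraic multiplicity; for symmetric [A] all the
   eigenvalues lie in [R]. *)
Definition spectrum (R : rcfType) (n : nat) (A : 'M[R]_n) : seq R :=
  flatten [seq nseq (mup x (char_poly A)) x | x <- rootsR (char_poly A)].

(* The default value 0 is only used for graphs with fewer than two vertices. *)
Definition alg_connectivity (R : rcfType) (T : finType) (G : sgraph T) : R :=
  nth 0 (spectrum (laplacian R G)) 1.

(* Main.v *)
(** Let [f] be an eigenfunction of [F_k(G)], orthogonal to the constants, for the
    eigenvalue [a_k = alpha(F_k(G))].  The function [g] on [(k-1)]-sets defined by
    [g S = \sum_(A contains S) f A] is orthogonal to the constants and satisfies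
    [L g = a_k g] in [F_(k-1)(G)], because exchanging two vertices commutes with
    inclusion.  As [a_k < alpha(F_(k-1)(G))], this forces [g = 0]
    (for [k = 1], [g] is just the total sum of [f]): for every
    [(k-1)]-set [S] the function [x |-> f (S + x)] has zero sum on [G - S].  The
    Dirichlet form of [f] on [F_k(G)] is the sum over [S] of those of these
    functions on [G - S], each of which is at least [alpha(G) - (k-1)] times their
    squared norm, and these squared norms add up to [k] times that of [f]. *)

Require Import Defs.
From mathcomp Require Import all_boot all_order all_algebra.
From mathcomp Require Import perm polyrcf complex spectral.

Set Implicit Arguments.
Unset Strict Implicit.
Unset Printing Implicit Defensive.

Import Order.TTheory GRing.Theory Num.Theory.

Local Open Scope ring_scope.

(** * Sorted spectra and factorizations of the characteristic polynomial *)

Lemma pairwise_flatten_nseq (R : rcfType) (m : R -> nat) (s : seq R) :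
  sorted <%R s -> pairwise <=%R (flatten [seq nseq (m x) x | x <- s]).
Proof.
rewrite lt_sorted_pairwise; elim: s => //= x s IHs /andP[x_lt /IHs s_le].
rewrite pairwise_cat s_le andbT; apply/andP; split; last first.
  by elim: (m x) => //= k ->; rewrite andbT; apply/allP => y /nseqP[-> _].
apply/allrelP => y z /nseqP[-> _] /flatten_mapP[t t_s /nseqP[-> _]].
exact/ltW/(allP x_lt).
Qed.

Lemma count_flatten_nseq (R : eqType) (m : R -> nat) (s : seq R) x :
  uniq s -> count_mem x (flatten [seq nseq (m y) y | y <- s]) = (if x \in s then m x else 0%N).
Proof.
elim: s => //= y s IHs /andP[y_s /IHs IH]; rewrite count_cat IH count_nseq inE /=.
have [->|] := eqVneq x y; first by rewrite (negPf y_s) addn0 mul1n.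
by rewrite mul0n.
Qed.

(** Both lists contain each [x] as often as its multiplicity as a root of the characteristic
    polynomial, which is 0 for a non-root. *)
Lemma perm_spectrum (R : rcfType) n (A : 'M[R]_n) (d : seq R) :
  char_poly A = \prod_(x <- d) ('X - x%:P) -> perm_eq (spectrum A) d.
Proof.
move=> charA; apply/allP => x _ /=; apply/eqP.
have charA0 : char_poly A != 0 by rewrite monic_neq0 ?char_poly_monic.
have uniqA : uniq (rootsR (char_poly A)) by apply: lt_sorted_uniq; exact: sorted_roots.
rewrite /spectrum count_flatten_nseq // -mu_prod_XsubC -charA.
have := roots_on_rootsR charA0 x; rewrite in_itv /= => <-.
by case: ifPn => // /mupNroot.
Qed.

(** The family [d] need not be sorted: a permutation [s] sorts it, and [i0], [i1] are the indices
    that it places first and second. *)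
Lemma spectrum_second (R : rcfType) n (A : 'M[R]_n) (d : 'I_n -> R) : (1 < n)%N ->
  char_poly A = \prod_i ('X - (d i)%:P) ->
  exists i0 i1 : 'I_n, [/\ i0 != i1, d i0 <= d i1, d i1 = nth 0 (spectrum A) 1
    & forall i, i != i0 -> d i1 <= d i].
Proof.
move=> n_gt1 charA; pose ds := [tuple d i | i < n].
have /perm_spectrum : char_poly A = \prod_(x <- ds) ('X - x%:P).
  by rewrite charA big_map big_enum.
case/tuple_permP => s defA; have n_gt0 := ltnW n_gt1.
have nthA i (lt_in : (i < n)%N) : nth 0 (spectrum A) i = d (s (Ordinal lt_in)).
  rewrite defA -[ i ]/(nat_of_ord (Ordinal lt_in)) -tnth_nth tnth_mktuple.
  by rewrite tnth_mktuple.
have sortA i j : (i < j < n)%N -> nth 0 (spectrum A) i <= nth 0 (spectrum A) j.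
  case/andP=> ij jn; have: pairwise <=%R (spectrum A).
    by apply: pairwise_flatten_nseq; exact: sorted_roots.
  have szA : size (spectrum A) = n by rewrite defA size_tuple.
  by move/(pairwiseP 0); apply; rewrite // inE szA // (ltn_trans ij).
exists (s (Ordinal n_gt0)), (s (Ordinal n_gt1)); split => //.
- by rewrite (inj_eq perm_inj).
- by rewrite -!nthA sortA.
move=> i ne_i; rewrite -[ i ](permKV s) -nthA.
case def_j: (s^-1%g i) => [[|[|j]] jn]; rewrite -nthA //; last by rewrite sortA.
case/eqP: ne_i; rewrite -[ i ](permKV s) def_j; congr (s _); exact: val_inj.
Qed.

(** * Spectral theorem and second eigenvalue of a real symmetric matrix *)

Section SymmetricMatrix.

Variables (R : rcfType) (n : nat) (A : 'M[R]_n).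
Hypothesis symA : A^T = A.

Local Notation C := R[i].
Local Notation toC := (real_complex R).

Lemma conj_real_complex (x : R) : Num.conj (x%:C)%C = (x%:C)%C.
Proof. by apply/CrealP/complex_realP; exists x. Qed.

Lemma map_conj_real_complex p q (B : 'M[R]_(p, q)) :
  map_mx Num.conj (map_mx toC B) = map_mx toC B.
Proof. by apply/matrixP => i j; rewrite !mxE conj_real_complex. Qed.

(** Over [R[i]] the matrix is Hermitian, hence unitarily diagonalizable with real eigenvalues. The
    factorization descends to [R] because the embedding is injective on polynomials. *)
Lemma symmetric_spectral_decomposition :
  exists P : 'M[C]_n, exists d : 'I_n -> R,
  [/\ P *m (map_mx Num.conj P^T) = 1%:M,
      P *m map_mx toC A = diag_mx (\row_i toC (d i)) *m P
    & char_poly A = \prod_i ('X - (d i)%:P)].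
Proof.
pose B := map_mx toC A; have hermB : B \is hermsymmx.
  by apply/is_hermitianmxP; rewrite expr0 scale1r map_trmx symA map_conj_real_complex.
have realD := hermitian_spectral_diag_real hermB.
have /hermitian_normalmx/orthomx_spectralP defB := hermB.
set P := spectralmx B in defB; set sp := spectral_diag B in defB realD.
have uP : P \is unitarymx := spectral_unitarymx B.
pose d i := complex.Re (sp 0 i).
have def_sp : sp = \row_i toC (d i).
  apply/rowP => i; rewrite mxE /d /=.
  by have /complex_realP[x ->] := mxOverP realD 0 i.
exists P, d; split; first exact/unitarymxP.
  by rewrite -/B {1}defB def_sp !mulmxA mulmxV ?mul1mx // unitarymx_unit.
apply: (map_poly_inj toC); rewrite map_char_poly -/B.
have -> : char_poly B = char_poly (diag_mx sp).
  (* Similarity is used after multiplying by the nonzero [\det Q], so no inverse of a polynomial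
     matrix is formed. *)
  pose Q := map_mx polyC P.
  have detQ0 : \det Q != 0.
    rewrite det_map_mx polyC_eq0 -unitfE -unitmxE; exact: unitarymx_unit.
  apply: (mulfI detQ0); rewrite -det_mulmx [RHS]mulrC -det_mulmx; congr (\det _).
  rewrite mulmxBr mulmxBl mul_scalar_mx mul_mx_scalar -!map_mxM /=; congr (_ - map_mx _ _).
  by rewrite {1}defB !mulmxA mulmxV ?mul1mx // unitarymx_unit.
rewrite char_poly_trig ?diag_mx_is_trig // rmorph_prod; apply: eq_bigr => i _.
by rewrite rmorphB /= map_polyX map_polyC /= mxE eqxx def_sp mxE.
Qed.


Lemma map_Re_mulmx p q r (B : 'M[R]_(p, q)) (w : 'M[C]_(q, r)) :
  map_mx (@complex.Re R) (map_mx toC B *m w) = B *m map_mx (@complex.Re R) w.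
Proof.
apply/matrixP => i j; rewrite !mxE (big_morph (@complex.Re R) (id1 := 0) (op1 := +%R)) //.
  by apply: eq_bigr => k _; rewrite !mxE; case: (w k j) => x y /=; rewrite mul0r subr0.
by case=> x y [].
Qed.

Lemma map_Im_mulmx p q r (B : 'M[R]_(p, q)) (w : 'M[C]_(q, r)) :
  map_mx (@complex.Im R) (map_mx toC B *m w) = B *m map_mx (@complex.Im R) w.
Proof.
apply/matrixP => i j; rewrite !mxE (big_morph (@complex.Im R) (id1 := 0) (op1 := +%R)) //.
  by apply: eq_bigr => k _; rewrite !mxE; case: (w k j) => x y /=; rewrite mul0r addr0.
by case=> x y [].
Qed.

(** As [A], [u] and [a] are real, the real and imaginary parts of [w] satisfy the same equations as
    [w], and one of them is nonzero. *)
Lemma real_eigenvector (u : 'cV[R]_n) (w : 'cV[C]_n) a :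
    w != 0 -> map_mx toC u^T *m w = 0 -> map_mx toC A *m w = toC a *: w ->
  exists v : 'cV[R]_n, [/\ v != 0, u^T *m v = 0 & A *m v = a *: v].
Proof.
rewrite -mul_scalar_mx -map_scalar_mx => w0 uw Aw.
have [Re0|Re_neq0] := eqVneq (map_mx (@complex.Re R) w) 0; last first.
  exists (map_mx (@complex.Re R) w); split=> //.
    by rewrite -map_Re_mulmx uw; apply/matrixP => i j; rewrite !mxE.
  by rewrite -map_Re_mulmx Aw map_Re_mulmx mul_scalar_mx.
exists (map_mx (@complex.Im R) w); split.
- apply: contraNneq w0 => Im0; apply/eqP/matrixP => i j.
  move/matrixP/(_ i j): Re0; move/matrixP/(_ i j): Im0; rewrite !mxE.
  by case: (w i j) => x y /= -> ->.
- by rewrite -map_Im_mulmx uw; apply/matrixP => i j; rewrite !mxE.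
by rewrite -map_Im_mulmx Aw map_Im_mulmx mul_scalar_mx.
Qed.

Hypothesis psdA : forall v : 'cV[R]_n, 0 <= (v^T *m A *m v) 0 0.
Variable u : 'cV[R]_n.
Hypotheses (n_gt1 : (1 < n)%N) (u0 : u != 0) (Au : A *m u = 0).

Lemma sqr_norm_ge0 (v : 'cV[R]_n) : 0 <= (v^T *m v) 0 0.
Proof. by rewrite mxE sumr_ge0 // => i _; rewrite mxE -expr2 sqr_ge0. Qed.

Lemma sqr_norm_eq0 (v : 'cV[R]_n) : ((v^T *m v) 0 0 == 0) = (v == 0).
Proof.
apply/idP/eqP => [|->]; last by rewrite mulmx0 mxE.
rewrite mxE psumr_eq0 => [/allP v0|i _]; last by rewrite mxE -expr2 sqr_ge0.
apply/colP => i; apply/eqP; have := v0 i; rewrite mem_index_enum => /(_ isT).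
by rewrite !mxE mulf_eq0 orbb.
Qed.

(** All is computed in eigenbasis coordinates. If [a] is positive, the kernel is the line spanned by
    [u], and vectors orthogonal to [u] involve only eigenvalues at least [a]; otherwise the
    inequality follows from [psdA]. *)
Lemma second_eigenvector : let a := nth 0 (spectrum A) 1 in
  (exists v : 'cV[R]_n, [/\ v != 0, u^T *m v = 0 & A *m v = a *: v]) /\
  (forall v : 'cV[R]_n, u^T *m v = 0 ->
     a * (v^T *m v) 0 0 <= (v^T *m A *m v) 0 0).
Proof.
move=> a; have [P [d [PP PA charA]]] := symmetric_spectral_decomposition.
have [i0 [i1 [i01 d01 d1 d_min]]] := spectrum_second n_gt1 charA.
rewrite -/a in d1; rewrite d1 in d_min d01.
pose Pt := map_mx Num.conj P^T; have PtP : Pt *m P = 1%:M by apply: mulmx1C.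
pose D := diag_mx (\row_i toC (d i)).
have APt : map_mx toC A *m Pt = Pt *m D.
  by rewrite -[LHS]mul1mx -PtP -!mulmxA [P *m _]mulmxA PA -mulmxA PP mulmx1.
(* [c v] holds the coordinates of [v] in the eigenbasis; the existential keeps [c] opaque. *)
have [c cE] : exists c, forall v : 'cV[R]_n, c v = P *m map_mx toC v.
  by exists (fun v => P *m map_mx toC v).
have du i : d i != 0 -> c u i 0 = 0.
  move=> di; have: D *m c u = 0 by rewrite cE mulmxA -PA -mulmxA -map_mxM Au map_mx0 mulmx0.
  move/matrixP/(_ i 0)/eqP; rewrite mul_diag_mx !mxE mulf_eq0 -{1}(rmorph0 toC).
  by rewrite (inj_eq (@complexI R)) (negPf di) => /eqP.
have dot v (w : 'cV[C]_n) : map_mx toC v^T *m (Pt *m w) = map_mx Num.conj (c v)^T *m w.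
  by rewrite mulmxA cE trmx_mul map_mxM map_trmx map_conj_real_complex.
have eigen (b : 'cV[C]_n) (x : R) (z : 'cV[R]_n) :
    b != 0 -> D *m b = toC x *: b -> map_mx Num.conj (c z)^T *m b = 0 ->
  exists v : 'cV[R]_n, [/\ v != 0, z^T *m v = 0 & A *m v = x *: v].
  move=> b0 Db ub; apply: (@real_eigenvector z (Pt *m b)).
  - by apply: contraNneq b0 => Pb; rewrite -[b]mul1mx -PP -mulmxA Pb mulmx0.
  - by rewrite dot.
  by rewrite mulmxA APt -mulmxA Db -scalemxAr.
have deltaE i : D *m delta_mx i 0 = toC (d i) *: (delta_mx i 0 : 'cV[C]_n).
  apply/matrixP => j k; rewrite mul_diag_mx !mxE.
  by have [->|] := eqVneq j i; rewrite ?mulr0.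
have delta_neq0 i : (delta_mx i 0 : 'cV[C]_n) != 0.
  by apply/eqP => /matrixP/(_ i 0)/eqP; rewrite !mxE !eqxx oner_eq0.
have d_ge0 i : 0 <= d i.
  (* With [z] equal to 0 the orthogonality condition is vacuous, so [d i] has a real eigenvector on
     which the form is nonnegative. *)
  have [|||v [v0 _ Av]] := eigen (delta_mx i 0) (d i) 0.
  - exact: delta_neq0.
  - exact: deltaE.
  - by rewrite cE map_mx0 mulmx0 trmx0 map_mx0 mul0mx.
  have := psdA v; rewrite -mulmxA Av -scalemxAr mxE pmulr_lge0 // lt_def sqr_norm_ge0.
  by rewrite sqr_norm_eq0 v0.
have col_c i : map_mx Num.conj (c u)^T *m delta_mx i 0 = (Num.conj (c u i 0))%:M.
  apply/matrixP => j k; rewrite !ord1 mxE (bigD1 i) //= big1 => [|l li].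
    by rewrite !mxE !eqxx mulr1 addr0 mulr1n.
  by rewrite !mxE (negPf li) mulr0.
split.
  (* If [u] has no [i1] component, the eigenvector at [i1] is already orthogonal to [u]. Otherwise
     [d i1] is 0, and [d i0] is squeezed to 0 as well. *)
  have [cu1|cu1] := eqVneq (c u i1 0) 0.
    apply: (eigen (delta_mx i1 0)); rewrite ?deltaE ?d1 //.
    by rewrite col_c cu1 rmorph0 raddf0.
  have a0 : a = 0 by apply/eqP; rewrite -d1; apply: contraNT cu1 => /du->.
  have d00 : d i0 = 0 by apply/eqP; rewrite eq_le d_ge0 -{1}a0 d01.
  (* The kernel has dimension at least 2, so it contains a vector orthogonal to [u]. *)
  pose b : 'cV[C]_n := Num.conj (c u i1 0) *: delta_mx i0 0 -
    Num.conj (c u i0 0) *: delta_mx i1 0.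
  apply: (eigen b).
  - apply/eqP => /matrixP/(_ i0 0)/eqP; rewrite !mxE !eqxx (negPf i01) mulr0 subr0 mulr1.
    by rewrite conjC_eq0 (negPf cu1).
  - by rewrite mulmxBr -!scalemxAr !deltaE d1 d00 a0 !scale0r !scaler0 subrr.
  rewrite mulmxBr -!scalemxAr.
  by rewrite !col_c !scale_scalar_mx mulrC subrr.
move=> v uv.
have [a_le0|a_gt0] := lerP a 0.
  by apply: le_trans (psdA v); rewrite mulr_le0_ge0 // sqr_norm_ge0.
have cu_eq0 i : i != i0 -> c u i 0 = 0.
  by move=> ii0; apply: du; rewrite gt_eqF // (lt_le_trans a_gt0) ?d_min.
have Ptc z : Pt *m c z = map_mx toC z by rewrite cE mulmxA PtP mul1mx.
have dotC (z : 'cV[R]_n) (w : 'cV[C]_n) :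
    (map_mx toC z^T *m (Pt *m w)) 0 0 = \sum_i Num.conj (c z i 0) * w i 0.
  by rewrite dot mxE; apply: eq_bigr => i _; rewrite !mxE.
(* Only the [i0] coordinate of [u] can be nonzero, so it is nonzero; orthogonality then kills that
   coordinate of [v]. *)
have cu0 : c u i0 0 != 0.
  apply: contraNneq u0 => cu0; have c0 : c u = 0.
    by apply/colP => i; rewrite [RHS]mxE; have [->|/cu_eq0] := eqVneq i i0; [exact: cu0|exact].
  by rewrite -(map_mx_eq0 toC) -Ptc c0 mulmx0.
have cv0 : c v i0 0 = 0.
  have : map_mx toC u^T *m (Pt *m c v) = 0 by rewrite Ptc -map_mxM uv map_mx0.
  move/matrixP/(_ 0 0)/eqP; rewrite dotC [X in _ == X]mxE (bigD1 i0) //= big1 => [|i ii0].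
    by rewrite addr0 mulf_eq0 conjC_eq0 (negPf cu0) => /eqP.
  by rewrite cu_eq0 // rmorph0 mul0r.
have vv : toC ((v^T *m v) 0 0) = \sum_i `|c v i 0| ^+ 2.
  transitivity ((map_mx toC v^T *m (Pt *m c v)) 0 0); first by rewrite Ptc -map_mxM [RHS]mxE.
  by rewrite dotC; apply: eq_bigr => i _; rewrite normCKC.
have vAv : toC ((v^T *m A *m v) 0 0) = \sum_i toC (d i) * `|c v i 0| ^+ 2.
  transitivity ((map_mx toC v^T *m (Pt *m (D *m c v))) 0 0).
    rewrite [Pt *m (D *m _)]mulmxA -APt -[_ *m Pt *m _]mulmxA Ptc.
    by rewrite -!map_mxM !mulmxA [RHS]mxE.
  rewrite dotC; apply: eq_bigr => i _; rewrite mul_diag_mx [in LHS]mxE [in LHS]mxE.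
  by rewrite mulrCA -normCKC.
rewrite -lecR rmorphM /= vv vAv mulr_sumr; apply: ler_sum => i _.
have [->|/d_min d_ge] := eqVneq i i0; first by rewrite cv0 normr0 expr0n !mulr0.
by rewrite ler_wpM2r ?exprn_ge0 // lecR.
Qed.


End SymmetricMatrix.

(** * The Laplacian as an operator on functions of the vertices *)

Section GraphLaplacian.

Variables (R : rcfType) (T : finType) (H : sgraph T).
Implicit Types f g : T -> R.

Definition graph_laplace f x : R := \sum_y (adj H x y)%:R * (f x - f y).

(** Ordered pairs count each edge twice; exchanging [x] and [y] in one of the two copies on the
    right assembles the squares. *)
Lemma dirichlet_form f :
  \sum_x \sum_y (adj H x y)%:R * (f x - f y) ^+ 2 = (\sum_x f x * graph_laplace f x) *+ 2.
Proof.
rewrite mulr2n.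
have -> : \sum_x f x * graph_laplace f x = \sum_x \sum_y (adj H x y)%:R * (f x * (f x - f y)).
  by apply: eq_bigr => x _; rewrite mulr_sumr; apply: eq_bigr => y _; rewrite mulrCA.
rewrite [X in _ + X]exchange_big -big_split; apply: eq_bigr => x _.
rewrite -big_split; apply: eq_bigr => y _ /=.
rewrite (adj_sym H y x) -mulrDr; congr (_ * _).
by rewrite -[f y - f x]opprB mulrN -mulrBl expr2.
Qed.

Definition vertex_col f : 'cV[R]_#|T| := \col_i f (enum_val i).

Lemma sum_enum_val (F : T -> R) : \sum_(i < #|T|) F (enum_val i) = \sum_x F x.
Proof. by rewrite [RHS](reindex _ (onW_bij _ (enum_val_bij T))). Qed.

Lemma laplacian_mul f : laplacian R H *m vertex_col f = vertex_col (graph_laplace f).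
Proof.
apply/colP => i; rewrite mulmxBl mul_diag_mx !mxE.
rewrite /graph_laplace (eq_bigr _ (fun y _ => mulrBr _ _ _)) sumrB; congr (_ - _).
  by rewrite -mulr_suml -natr_sum -big_mkcond sum1_card cardsE.
by rewrite -sum_enum_val; apply: eq_bigr => j _; rewrite !mxE.
Qed.

Lemma vertex_col_dot f g : ((vertex_col f)^T *m vertex_col g) 0 0 = \sum_x f x * g x.
Proof. by rewrite mxE -sum_enum_val; apply: eq_bigr => i _; rewrite !mxE. Qed.

Lemma laplacian_form f :
  ((vertex_col f)^T *m laplacian R H *m vertex_col f) 0 0 = \sum_x f x * graph_laplace f x.
Proof. by rewrite -mulmxA laplacian_mul vertex_col_dot. Qed.

Lemma vertex_col_surj (v : 'cV[R]_#|T|) : v = vertex_col (fun x => v (enum_rank x) 0).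
Proof. by apply/colP => i; rewrite mxE enum_valK. Qed.

(** This is [second_eigenvector] with [u] the all-ones vector, which lies in the kernel; the
    Dirichlet form gives positivity. *)
Lemma alg_connectivityP : (1 < #|T|)%N ->
  (exists f, [/\ exists x, f x != 0, \sum_x f x = 0
     & forall x, graph_laplace f x = alg_connectivity R H * f x]) /\
  (forall f, \sum_x f x = 0 ->
     alg_connectivity R H * \sum_x f x ^+ 2 <= \sum_x f x * graph_laplace f x).
Proof.
move=> T_gt1; have symL : (laplacian R H)^T = laplacian R H.
  apply/matrixP => i j; rewrite !mxE adj_sym (eq_sym j i).
  by case: eqVneq => [->|].
have psdL (v : 'cV[R]_#|T|) : 0 <= (v^T *m laplacian R H *m v) 0 0.
  rewrite [v]vertex_col_surj laplacian_form -(pmulrn_lge0 _ (isT : (0 < 2)%N)) -dirichlet_form.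
  by do 2!(apply: sumr_ge0 => ? _); rewrite mulr_ge0 ?ler0n ?sqr_ge0.
have one_neq0 : vertex_col (fun=> 1) != 0.
  apply/eqP => /matrixP/(_ (Ordinal (ltnW T_gt1)) 0)/eqP.
  by rewrite !mxE oner_eq0.
have L1 : laplacian R H *m vertex_col (fun=> 1) = 0.
  rewrite laplacian_mul; apply/colP => i.
  by rewrite !mxE /graph_laplace big1 // => y _; rewrite subrr mulr0.
have dot1 f : (vertex_col (fun=> 1))^T *m vertex_col f = (\sum_x f x)%:M.
  apply/matrixP => i j; rewrite !ord1 vertex_col_dot mxE eqxx mulr1n.
  by apply: eq_bigr => x _; rewrite mul1r.
have [[v [v0 v1 Lv]] rayleigh] := second_eigenvector symL psdL T_gt1 one_neq0 L1.
split; last first.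
  move=> f f0; have := rayleigh (vertex_col f); rewrite dot1 f0 raddf0 => /(_ erefl).
  by rewrite vertex_col_dot laplacian_form; under [in X in X -> _]eq_bigr do rewrite -expr2.
move: v0 v1 Lv; rewrite [v]vertex_col_surj; set f := fun _ => _ => f_neq0 f1 Lf.
exists f; split.
- have [x fx|f0] := pickP (fun x => f x != 0); first by exists x.
  by case/eqP: f_neq0; apply/colP => i; rewrite !mxE; apply/eqP/negbFE/f0.
- by move/matrixP/(_ 0 0): f1; rewrite dot1 !mxE eqxx mulr1n.
move=> x; move: Lf; rewrite laplacian_mul => /matrixP/(_ (enum_rank x) 0).
by rewrite !mxE enum_rankK.
Qed.

End GraphLaplacian.

(* Extend [f] by zero on [S]: each vertex outside [S] has at most [#|S|] edges to [S]. *)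
Lemma deleted_rayleigh (R : rcfType) (T : finType) (G : sgraph T) (S : {set T}) (f : T -> R) :
    (1 < #|T|)%N -> \sum_(x in ~: S) f x = 0 ->
  (alg_connectivity R G - #|S|%:R) * (\sum_(x in ~: S) f x ^+ 2) *+ 2 <=
  \sum_(x in ~: S) \sum_(y in ~: S) (adj G x y)%:R * (f x - f y) ^+ 2.
Proof.
move=> T_gt1 f0; pose g x := if x \in ~: S then f x else 0.
have sum_g (F : R -> R) : F 0 = 0 -> \sum_x F (g x) = \sum_(x in ~: S) F (f x).
  by move=> F0; rewrite [RHS]big_mkcond; apply: eq_bigr => x _; rewrite /g; case: ifP.
have [_ /(_ g)] := alg_connectivityP R G T_gt1.
rewrite (sum_g id) // => /(_ f0); rewrite (sum_g (fun z => z ^+ 2)) ?expr0n //.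
move/(ler_wMn2r 2); rewrite -dirichlet_form.
set E := \sum_x _; set N := \sum_(x in _) _ => le_E.
rewrite mulrBl mulrnBl lerBlDr; apply: le_trans le_E _.
(* [cut] collects the edges between [S] and its complement, where [g] vanishes at one end. They
   occur in [E] in both orders, and edges inside [S] contribute 0. *)
pose cut := \sum_(x in ~: S) \sum_(y in S) (adj G x y)%:R * f x ^+ 2.
have -> : E = \sum_(x in ~: S) \sum_(y in ~: S) (adj G x y)%:R * (f x - f y) ^+ 2 + cut *+ 2.
  rewrite /E (bigID (mem (~: S))) /= mulr2n addrA; congr (_ + _).
    rewrite /cut -big_split; apply: eq_bigr => x xS /=.
    rewrite (bigID (mem (~: S))) /=; congr (_ + _).
      by apply: eq_bigr => y yS; rewrite /g xS yS.
    rewrite (eq_bigl (fun y => y \in S)) => [|y]; last by rewrite !inE negbK.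
    by apply: eq_bigr => y yS; rewrite /g xS inE yS subr0.
  rewrite (eq_bigl (fun y => y \in S)) => [|y]; last by rewrite !inE negbK.
  rewrite /cut [RHS]exchange_big; apply: eq_bigr => x xS.
  rewrite [RHS]big_mkcond; apply: eq_bigr => y _.
  rewrite adj_sym /g !inE xS /=; case: (y \in S) => /=; first by rewrite subrr expr0n mulr0.
  by rewrite sub0r sqrrN.
rewrite lerD2l lerMn2r /= /cut /N mulr_sumr; apply: ler_sum => x _.
rewrite -mulr_suml ler_wpM2r ?sqr_ge0 // -natr_sum ler_nat.
by rewrite -sum1_card; apply: leq_sum => y _; case: adj.
Qed.

(** * Token moves as transpositions, and the passage to sets with one element less *)

Section TokenLaplacian.

Variables (R : rcfType) (T : finType) (G : sgraph T).
Implicit Types (F : {set T} -> R) (A S : {set T}).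

Lemma sum_ksubset k F : \sum_(A : ksubset T k) F (val A) = \sum_(A : {set T} | #|A| == k) F A.
Proof.
rewrite [RHS](reindex_omap (val : ksubset T k -> {set T}) insub) => [|A kA].
  by apply: eq_bigl => A; rewrite (valP A) valK eqxx.
by rewrite insubT.
Qed.

Lemma card_ksubset_gt1 k : (0 < k < #|T|)%N -> (1 < #|ksubset T k|)%N.
Proof.
case/andP=> k_gt0 k_lt; rewrite card_sig -cardsE card_draws.
case: k k_gt0 k_lt => // k _; case: #|T| => // m; rewrite ltnS => km.
rewrite binS addnC -[2%N]/(1 + 1)%N leq_add // bin_gt0 //; exact: ltnW.
Qed.

(** Each neighbour of [A] comes from exactly one edge leaving [A], by moving the token at [a] to
    [b]. *)
Lemma sum_token_adj k (A : ksubset T k) F :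
  \sum_(B : ksubset T k) (token_adj G A B)%:R * F (val B) =
  \sum_(a in val A) \sum_(b in ~: val A) (adj G a b)%:R * F (b |: val A :\ a).
Proof.
set X := val A; pose D := [set p : T * T | [&& p.1 \in X, p.2 \notin X & adj G p.1 p.2]].
pose h (p : T * T) := p.2 |: X :\ p.1.
have h_inj : {in D &, injective h}.
  case=> a b [c d]; rewrite !inE /= => /and3P[aX bX _] /and3P[cX dX _] eq_h.
  have := setU11 b (X :\ a); rewrite -/(h (a, b)) eq_h.
  rewrite !inE (negPf bX) andbF orbF => /eqP/= eq_b.
  rewrite eq_b in eq_h *; congr (_, _).
  have := erefl (a \in h (a, d)); rewrite {1}eq_h !inE /= eqxx aX /= andbT orbF.
  by rewrite (negPf (memPn dX _ aX)) /= => /negbFE/eqP.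
have adjE B : token_adj G A B = (val B \in h @: D).
  apply/exists_inP/imsetP => [[a aX /exists_inP[b bB /andP[/eqP eqAB ab]]]|].
    (* The symmetric difference is read pointwise as an exclusive or. *)
    have E x : (x \in X) (+) (x \in val B) = (x == a) || (x == b).
      by have /setP/(_ x) := eqAB; rewrite !inE => <-; rewrite -/X; do 2!case: (_ \in _).
    have aB : a \notin val B by have := E a; rewrite aX eqxx /= => ->.
    have bX : b \notin X by have := E b; rewrite bB eqxx orbT addbT.
    exists (a, b); first by rewrite inE aX bX.
    apply/setP => x; have := E x; rewrite !inE /=.
    have [->|_] := eqVneq x a; first by rewrite aX (negPf aB) (negPf (memPn bX _ aX)).
    have [->|_] := eqVneq x b; first by rewrite bB.
    by rewrite /=; do 2!case: (_ \in _).
  case=> -[a b]; rewrite inE /= => /and3P[aX bX ab] defB; have ba := negPf (memPn bX _ aX).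
  exists a => //; apply/exists_inP; exists b; first by rewrite defB setU11.
  rewrite ab andbT defB; apply/eqP/setP => x; rewrite !inE /= -/X.
  have [->|_] := eqVneq x a; first by rewrite aX ba.
  have [->|_] := eqVneq x b; first by rewrite bX.
  by rewrite /=; case: (_ \in _).
transitivity (\sum_(p in D) F (h p)); last first.
  rewrite pair_big_dep /= [RHS](bigID (fun p => adj G p.1 p.2)) /= addrC.
  rewrite [X in _ = X + _]big1 ?add0r => [|p].
    apply: eq_big => [p|p]; rewrite !inE -?andbA // => /and3P[_ _ ->].
    by rewrite mul1r.
  by case/andP=> _ /negPf->; rewrite mul0r.
rewrite -(big_imset F h_inj) /=.
rewrite (eq_bigr (fun B => (val B \in h @: D)%:R * F (val B))) => [|B _]; last by rewrite adjE.
rewrite (sum_ksubset k (fun B => (B \in h @: D)%:R * F B)) big_mkcond [RHS]big_mkcond.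
(* Moving a token preserves the size, so restricting to sets of size [k] loses nothing from the
   image of [h]. *)
apply: eq_bigr => B _ /=; case: imsetP => [[[a b]]|_]; last by rewrite mul0r if_same.
rewrite inE /= => /and3P[aX bX _] ->; rewrite mul1r ifT //.
have := valP A; rewrite /= -/X (cardsD1 a) aX.
by rewrite cardsU1 !inE (negPf bX) andbF.
Qed.

(** A set of size [k.+1] with a marked element is the same thing as a set of size [k] with a marked
    point outside it. *)
Lemma sum_remove k (Phi : {set T} -> T -> R) :
  \sum_(A : {set T} | #|A| == k.+1) \sum_(a in A) Phi (A :\ a) a =
  \sum_(S : {set T} | #|S| == k) \sum_(a in ~: S) Phi S a.
Proof.
rewrite !pair_big_dep /=.
rewrite (reindex_onto (fun p : {set T} * T => (p.2 |: p.1, p.2))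
                      (fun p => (p.1 :\ p.2, p.2))) /=; last first.
  by case=> A a /andP[_ aA] /=; rewrite setD1K.
apply: eq_big => [[S a]|[S a]] /=.
  rewrite xpair_eqE eqxx andbT setU11 andbT inE.
  apply/andP/andP => [[kS /eqP defS]|[kS aS]].
    have aS : a \notin S by rewrite -defS setD11.
    by move: kS; rewrite cardsU1 aS.
  by rewrite cardsU1 aS (eqP kS) setU1K.
by case/andP => _ /eqP[->].
Qed.

(* [tperm a b] fixes [A] unless exactly one of [a] and [b] is in [A], so this is
   twice the Laplacian of the token graph, on sets of all sizes at once. *)
Definition exchange F A : R :=
  \sum_a \sum_b (adj G a b)%:R * (F A - F (tperm a b @: A)).

(** The sum over ordered pairs meets each edge leaving [A] twice, once from each end. *)
Lemma graph_laplace_token k F (A : ksubset T k) :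
  graph_laplace (token_graph G k) (fun B => F (val B)) A *+ 2 = exchange F (val A).
Proof.
rewrite /graph_laplace /= (sum_token_adj A (fun B => F (val A) - F B)).
set X := val A; pose W a b := (adj G a b)%:R * (F X - F (tperm a b @: X)).
have tpermX a b : (a \in X) = (b \in X) -> tperm a b @: X = X.
  move=> eq_ab; apply/setP => x; rewrite -{1}[x](tpermK a b) mem_imset; last exact: perm_inj.
  by case: tpermP => [->|->|].
have W0 a b : (a \in X) = (b \in X) -> W a b = 0.
  by move/tpermX=> tX; rewrite /W tX subrr mulr0.
have W_sym a b : W a b = W b a by rewrite /W adj_sym tpermC.
transitivity ((\sum_(a in X) \sum_(b in ~: X) W a b) *+ 2).
  congr (_ *+ 2); apply: eq_bigr => a aX; apply: eq_bigr => b; rewrite inE => bX.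
  congr (_ * (_ - F _)); apply/setP => x.
  rewrite -[x in RHS](tpermK a b) mem_imset; last exact: perm_inj.
  rewrite !inE; case: tpermP => [->|->|/eqP/negPf-> /eqP/negPf-> //].
    by rewrite eqxx (negPf bX) (negPf (memPn bX _ aX)).
  by rewrite eqxx aX.
have splitX (f : T -> R) : \sum_a f a = \sum_(a in X) f a + \sum_(a in ~: X) f a.
  by rewrite (bigID (mem X)) /=; congr (_ + _); apply: eq_bigl => a; rewrite inE.
rewrite /exchange splitX mulr2n; congr (_ + _).
  apply: eq_bigr => a aX; rewrite splitX [X in _ = X + _]big1 ?add0r // => b bX.
  by apply: W0; rewrite aX bX.
rewrite exchange_big; apply: eq_bigr => a; rewrite inE => aX.
rewrite splitX [X in _ = _ + X]big1 ?addr0 => [|b]; last first.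
  by rewrite inE => bX; apply: W0; rewrite (negPf aX) (negPf bX).
by apply: eq_bigr => b _; rewrite W_sym.
Qed.

(** Stated through inclusion and size, which permutations of the vertices preserve, so that
    equivariance is immediate; [upE] gives the form with an added element. *)
Definition up F S : R := \sum_(A : {set T} | (S \subset A) && (#|A| == #|S|.+1)) F A.

Lemma upE F S : up F S = \sum_(a in ~: S) F (a |: S).
Proof.
rewrite -(@big_imset _ _ _ _ _ (fun a => a |: S) (mem (~: S)) F) => [|a b]; last first.
  rewrite !inE => aS bS eq_ab; have := setU11 a S.
  by rewrite eq_ab !inE (negPf aS) orbF => /eqP.
apply: eq_bigl => A; apply/andP/imsetP => [[sSA /eqP cardA]|[a aS ->]].
  have: #|A :\: S| == 1%N by rewrite cardsD (setIidPr sSA) cardA subSnn.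
  case/cards1P => a defa; exists a; first by have := set11 a; rewrite -defa !inE => /andP[].
  by rewrite -{1}(setID A S) (setIidPr sSA) defa setUC.
by rewrite subsetUr cardsU1 -in_setC aS.
Qed.

Lemma imset_tpermK (a b : T) : involutive (fun A : {set T} => tperm a b @: A).
Proof.
move=> A; rewrite -imset_comp -[RHS]imset_id; apply: eq_imset => x /=; exact: tpermK.
Qed.

Lemma up_tperm F S a b : up F (tperm a b @: S) = up (fun A => F (tperm a b @: A)) S.
Proof.
rewrite /up (reindex_inj (inv_inj (imset_tpermK a b))); apply: eq_bigl => A.
rewrite !card_imset; try exact: perm_inj; congr (_ && _).
apply/idP/idP => [/(imsetS (tperm a b))|]; last exact: imsetS.
by rewrite !imset_tpermK.
Qed.

(** [up] is linear and commutes with every transposition, hence with the weighted sum of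
    transpositions defining [exchange]. *)
Lemma exchange_up F S : exchange (up F) S = up (exchange F) S.
Proof.
rewrite [in RHS]/up [RHS]exchange_big; apply: eq_bigr => a _.
rewrite [RHS]exchange_big; apply: eq_bigr => b _.
by rewrite up_tperm -mulr_sumr sumrB.
Qed.

End TokenLaplacian.


(** * Functions annihilated by [up], and the lower bound *)

Section HarmonicEigenvalue.

Variables (R : rcfType) (T : finType) (G : sgraph T).
Hypothesis T_gt1 : (1 < #|T|)%N.

(** Group the token moves by the set [S] of the [k] tokens that stay and apply [deleted_rayleigh] to
    each group. The factor [k.+1] counts the ways to choose the moving token in [A]. *)
Lemma harmonic_rayleigh k (F : {set T} -> R) :
    (forall S : {set T}, #|S| == k -> up F S = 0) ->
  k.+1%:R * (alg_connectivity R G - k%:R) * \sum_(A : ksubset T k.+1) F (val A) ^+ 2 <=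
  \sum_(A : ksubset T k.+1)
     F (val A) * graph_laplace (token_graph G k.+1) (fun B => F (val B)) A.
Proof.
move=> upF0; rewrite -(ler_pMn2r (isT : (0 < 2)%N)).
rewrite -(dirichlet_form (token_graph G k.+1) (fun B => F (val B))) /=.
have -> : \sum_(A : ksubset T k.+1) \sum_(B : ksubset T k.+1)
      (token_adj G A B)%:R * (F (val A) - F (val B)) ^+ 2 =
    \sum_(S : {set T} | #|S| == k) \sum_(a in ~: S) \sum_(b in ~: S)
      (adj G a b)%:R * (F (a |: S) - F (b |: S)) ^+ 2.
  under eq_bigr => A _ do rewrite (sum_token_adj G A (fun B => (F (val A) - F B) ^+ 2)).
  rewrite -(sum_remove k (fun S a => \sum_(b in ~: S)
    (adj G a b)%:R * (F (a |: S) - F (b |: S)) ^+ 2)).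
  rewrite (sum_ksubset k.+1 (fun A => \sum_(a in A) \sum_(b in ~: A)
    (adj G a b)%:R * (F A - F (b |: A :\ a)) ^+ 2)).
  apply: eq_bigr => A _; apply: eq_bigr => a aA; rewrite setD1K //.
  (* The complement of [A :\ a] also contains [a], but the term [b = a] vanishes since there are no
     loops. *)
  rewrite [RHS](bigD1 a) ?inE ?eqxx //= adj_irr mul0r add0r; apply: eq_bigl => b.
  by rewrite !inE negb_and negbK; have [->|] := eqVneq b a; rewrite ?aA ?andbT.
have -> : k.+1%:R * (alg_connectivity R G - k%:R) * \sum_(A : ksubset T k.+1) F (val A) ^+ 2 =
    (alg_connectivity R G - k%:R) *
      \sum_(S : {set T} | #|S| == k) \sum_(a in ~: S) F (a |: S) ^+ 2.
  rewrite mulrAC mulrC; congr (_ * _).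
  rewrite -(sum_remove k (fun S a => F (a |: S) ^+ 2)) (sum_ksubset k.+1 (fun A => F A ^+ 2)).
  rewrite mulr_sumr; apply: eq_bigr => A /eqP cardA.
  rewrite (eq_bigr (fun=> F A ^+ 2)) => [|a aA]; last by rewrite setD1K.
  by rewrite sumr_const cardA mulr_natl.
rewrite mulr_sumr -sumrMnl; apply: ler_sum => S /eqP cardS.
by rewrite -cardS; apply: deleted_rayleigh => //; rewrite -upE upF0 ?cardS.
Qed.

(** For positive [k], [up F] has zero sum and satisfies the eigenvalue equation for a value below
    the algebraic connectivity one level down, so the Rayleigh bound leaves only 0. *)
Lemma up_eigenfunction_eq0 k (F : {set T} -> R) : (k < #|T|)%N ->
    \sum_(A : ksubset T k.+1) F (val A) = 0 ->
    (forall A : ksubset T k.+1, graph_laplace (token_graph G k.+1) (fun B => F (val B)) A =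
       alg_connectivity R (token_graph G k.+1) * F (val A)) ->
    ((0 < k)%N ->
      alg_connectivity R (token_graph G k.+1) < alg_connectivity R (token_graph G k)) ->
  forall S : {set T}, #|S| == k -> up F S = 0.
Proof.
move=> k_lt sumF eigF a_lt.
have sum_up : \sum_(S : ksubset T k) up F (val S) = 0.
  rewrite (sum_ksubset k (up F)); under eq_bigr do rewrite upE.
  rewrite -(sum_remove k (fun S x => F (x |: S))).
  transitivity (k.+1%:R * \sum_(A : ksubset T k.+1) F (val A)); last by rewrite sumF mulr0.
  rewrite (sum_ksubset k.+1 F) mulr_sumr; apply: eq_bigr => A /eqP cardA.
  rewrite (eq_bigr (fun=> F A)) => [|x xA]; last by rewrite setD1K.
  by rewrite sumr_const cardA mulr_natl.
case: k => [|k] in k_lt sumF eigF a_lt sum_up *.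
  (* For [k = 0] the only [S] is empty, and [sum_up] is the claim itself. *)
  move=> S; rewrite cards_eq0 => /eqP->; move: sum_up; rewrite (sum_ksubset 0 (up F)).
  rewrite (eq_bigl (pred1 set0)) ?big_pred1_eq // => A.
  by rewrite cards_eq0.
set a := alg_connectivity R _ in eigF a_lt.
move=> S cardS; pose g (B : ksubset T k.+1) := up F (val B).
have eigg B : graph_laplace (token_graph G k.+1) g B = a * g B.
  have two_neq0 : (2 != 0 :> R) by rewrite pnatr_eq0.
  (* Doubling both sides turns the two token Laplacians into the single operator [exchange]. *)
  apply: (mulIf two_neq0); rewrite !mulr_natr (graph_laplace_token G (up F) B) exchange_up.
  rewrite /g /up -mulrnAr -sumrMnl mulr_sumr; apply: eq_bigr => A /andP[_ cardA].
  have kA : #|A| == k.+2 by rewrite (eqP cardA) (eqP (valP B)).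
  have := graph_laplace_token G F (Sub A kA : ksubset T k.+2).
  by rewrite SubK eigF SubK => <-; rewrite mulrnAr.
have cardk : (1 < #|ksubset T k.+1|)%N by rewrite card_ksubset_gt1 //.
have [_ /(_ g sum_up)] := alg_connectivityP R (token_graph G k.+1) cardk.
rewrite [X in _ <= X](eq_bigr (fun B => a * g B ^+ 2)) => [|B _]; last first.
  by rewrite eigg mulrCA expr2.
rewrite -mulr_sumr -subr_le0 -mulrBl pmulr_rle0 ?subr_gt0 ?a_lt // => sqg_le0.
have : \sum_B g B ^+ 2 == 0 by rewrite eq_le sqg_le0 sumr_ge0 // => B _; rewrite sqr_ge0.
rewrite psumr_eq0 => [/allP/(_ (Sub S cardS))|B _]; last exact: sqr_ge0.
by rewrite mem_index_enum sqrf_eq0 /g SubK => /(_ isT)/eqP.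
Qed.

Lemma token_connectivity_lower_bound k : (k.+1 < #|T|)%N ->
    ((0 < k)%N ->
      alg_connectivity R (token_graph G k.+1) < alg_connectivity R (token_graph G k)) ->
  k.+1%:R * (alg_connectivity R G - k%:R) <= alg_connectivity R (token_graph G k.+1).
Proof.
move=> k_lt a_lt.
have cardk : (1 < #|ksubset T k.+1|)%N by rewrite card_ksubset_gt1.
have [[f [[A0 fA0] sumf eigf]] _] := alg_connectivityP R (token_graph G k.+1) cardk.
(* The value 0 off the sets of size [k.+1] only makes [F] total; the sums below evaluate [F] at sets
   of that size. *)
pose F (A : {set T}) := if insub A is Some B then f B else 0.
have FE B : F (val B) = f B by rewrite /F valK.
have lapF A : graph_laplace (token_graph G k.+1) (fun B => F (val B)) A =
    alg_connectivity R (token_graph G k.+1) * F (val A).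
  by rewrite FE -eigf; apply: eq_bigr => B _; rewrite !FE.
have sumF : \sum_(A : ksubset T k.+1) F (val A) = 0.
  by rewrite (eq_bigr f).
have := harmonic_rayleigh (up_eigenfunction_eq0 (ltnW k_lt) sumF lapF a_lt).
rewrite [X in _ <= X](eq_bigr (fun A : ksubset T k.+1 =>
  alg_connectivity R (token_graph G k.+1) * F (val A) ^+ 2)) => [|A _].
  rewrite -mulr_sumr ler_pM2r // lt_def sumr_ge0 => [|A _]; last exact: sqr_ge0.
  rewrite andbT psumr_eq0 => [|A _]; last exact: sqr_ge0.
  apply/allPn; exists A0; first exact: mem_index_enum.
  by rewrite /= sqrf_eq0 FE.
by rewrite lapF mulrCA expr2.
Qed.

End HarmonicEigenvalue.

Theorem theorem3p1 (R : rcfType) (n k : nat) (G : sgraph 'I_n)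
    (hk : (1 <= k <= n - 1)%N)
    (hchain : sorted >%R (alg_connectivity R G ::
       [seq alg_connectivity R (token_graph G j) | j <- index_iota 2 k.+1])) :
  k%:R * (alg_connectivity R G - k%:R + 1) <= alg_connectivity R (token_graph G k).
Proof.
case: k hk hchain => // k /andP[_ k_le] hchain.
have k_lt : (k.+1 < n)%N by rewrite -ltn_predRL -subn1.
have n_gt1 : (1 < #|'I_n|)%N by rewrite card_ord (leq_ltn_trans _ k_lt).
(* The instance [k = 0] of the bound compares [G] with its 1-token graph without building an
   isomorphism. *)
have base : alg_connectivity R G <= alg_connectivity R (token_graph G 1).
  have := @token_connectivity_lower_bound R _ G n_gt1 0.
  by rewrite card_ord subr0 mul1r; apply; rewrite // (leq_ltn_trans _ k_lt).
rewrite -addn1 natrD opprD addrA addrNK natr1 addn1.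
apply: token_connectivity_lower_bound => //; first by rewrite card_ord.
(* The inequality between consecutive levels comes from the chain; for 2 tokens its first link is
   combined with [base]. *)
case: k k_lt hchain {k_le} => // -[|k] k_lt hchain _.
  by case/andP: hchain => a_lt _; apply: lt_le_trans base.
(* Without its head the chain starts at 2 tokens, so positions [k] and [k.+1] hold the values for
   [k.+2] and [k.+3] tokens. *)
have := path_sorted hchain; rewrite /index_iota => /(sortedP 0)/(_ k).
rewrite size_map size_iota !subSS subn0 ltnSn => /(_ isT).
by rewrite !(nth_map 0%N) ?size_iota ?nth_iota // !add2n.
Qed.
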